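(* For any positive integer $m$, there is an ancient curve shortening flow $(M_t)_{t\in(-\infty,0)}$ in some Euclidean space $\mathbb{R}^N$ such that, for every $t<0$, $M_t$ does not lie in any $(2m-1)$-dimensional Euclidean subspace, and whose tangent flow at $t=0$ is the multiplicity $1$ circle.
   Context: A family of immersed curves $M_t\subset\mathbb{R}^N$ is a curve shortening flow if its position vector satisfies $\partial_t x=\Delta_{M_t}x$, where $\Delta_{M_t}$ is the Laplacian of the induced metric applied to each coordinate; for a parametrization $\gamma_t(\theta)$, $\Delta_{\gamma_t}=\frac{1}{|\partial_\theta\gamma_t|}\partial_\theta\big(\frac{1}{|\partial_\theta\gamma_t|}\partial_\theta\,\cdot\big)$. It is ancient if it is defined for all $t\in(-\infty,0)$. A Euclidean subspace means an affine subspace. The tangent flow of an ancient solution $M_t$ at $0$ is the limit of the rescaled immersed curves $\frac{M_t}{\sqrt{-t}}$ as $t\to0$. The multiplicity $1$ circle is a round circle centered at the origin in a 2-plane, traversed once. *)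

(* Defs.v *)
From mathcomp Require Import all_boot all_order all_algebra.
From mathcomp Require Import all_classical all_reals all_analysis.

Set Implicit Arguments.
Unset Strict Implicit.
Unset Printing Implicit Defensive.

Import Order.TTheory GRing.Theory Num.Theory.
Import numFieldNormedType.Exports.

Local Open Scope classical_set_scope.
Local Open Scope ring_scope.

(* The library norm on 'rV[R]_N is the sup norm, hence [enorm]; it induces the
   same topology as [enorm], so library derivatives of curves are the usual
   ones. *)
Definition dotp (R : realType) (N : nat) (u v : 'rV[R]_N) : R :=
  \sum_(i < N) u 0 i * v 0 i.

Definition enorm (R : realType) (N : nat) (u : 'rV[R]_N) : R :=
  Num.sqrt (dotp u u).

Definition smooth (R : realType) (V : normedModType R) (f : R -> V) : Prop :=
  forall (n : nat) (x : R), derivable (derive1n n f) x 1.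

(* [f t x] is jointly of class C^k on {t < 0} x R: all iterated partial
   derivatives of order at most k exist and are jointly continuous there. *)
Fixpoint Ck_family (R : realType) (V : normedModType R) (k : nat)
    (f : R -> R -> V) : Prop :=
  (forall t x : R, t < 0 -> {for (t, x), continuous (fun p => f p.1 p.2)}) /\
  (if k is k'.+1 then
     [/\ forall t x : R, t < 0 ->
           derivable (fun s => f s x) t 1 /\ derivable (f t) x 1,
         Ck_family k' (fun t x => derive1 (fun s => f s x) t)
       & Ck_family k' (fun t x => derive1 (f t) x)]
   else True).

Definition smooth_family (R : realType) (V : normedModType R)
    (f : R -> R -> V) : Prop :=
  forall k : nat, Ck_family k f.

(* Closed curves are parametrized by the circle R / (2 pi Z). *)
Definition immersed_closed_curve (R : realType) (N : nat)
    (g : R -> 'rV[R]_N) : Prop :=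
  [/\ smooth g,
      forall x : R, g (x + 2 * pi) = g x
    & forall x : R, derive1 g x != 0].

Definition speed (R : realType) (N : nat) (g : R -> 'rV[R]_N) (x : R) : R :=
  enorm (derive1 g x).

(* Laplacian of the metric induced by [g], acting on functions of the
   parameter; on a vector-valued [f] it acts coordinatewise. *)
Definition laplacian (R : realType) (N : nat) (V : normedModType R)
    (g : R -> 'rV[R]_N) (f : R -> V) (x : R) : V :=
  (speed g x)^-1 *: derive1 (fun y => (speed g y)^-1 *: derive1 f y) x.

(* The values of [gam] at nonnegative times are irrelevant. *)
Definition ancient_csf (R : realType) (N : nat)
    (gam : R -> R -> 'rV[R]_N) : Prop :=
  [/\ smooth_family gam,
      forall t : R, t < 0 -> immersed_closed_curve (gam t)
    & forall t x : R, t < 0 ->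
        derive1 (fun s => gam s x) t = laplacian (gam t) (gam t) x].

Definition lies_in_affine (R : realType) (N : nat) (g : R -> 'rV[R]_N)
    (p : 'rV[R]_N) (V : {vspace 'rV[R]_N}) : Prop :=
  forall x : R, g x - p \in V.

(* Lift to R of a diffeomorphism of R / (2 pi Z), of either orientation. *)
Definition circle_diffeo (R : realType) (phi : R -> R) : Prop :=
  [/\ smooth phi,
      forall x : R, derive1 phi x != 0
    & (forall x : R, phi (x + 2 * pi) = phi x + 2 * pi) \/
      (forall x : R, phi (x + 2 * pi) = phi x - 2 * pi)].

(* C^oo convergence of closed curves up to reparametrization: after composing
   with circle diffeomorphisms, every derivative converges uniformly. *)
Definition curves_cvg (R : realType) (N : nat) (F : set_system R)
    (c : R -> R -> 'rV[R]_N) (G : R -> 'rV[R]_N) : Prop :=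
  exists2 phi : R -> R -> R,
    \forall t \near F, circle_diffeo (phi t)
  & forall (j : nat) (e : R), 0 < e ->
      \forall t \near F, forall x : R,
        enorm (derive1n j (fun y => c t (phi t y)) x - derive1n j G x) < e.

Definition tangent_flow_at0 (R : realType) (N : nat)
    (gam : R -> R -> 'rV[R]_N) (G : R -> 'rV[R]_N) : Prop :=
  curves_cvg (0^'-) (fun t x => (Num.sqrt (- t))^-1 *: gam t x) G.

Definition mult1_circle (R : realType) (N : nat) (G : R -> 'rV[R]_N) : Prop :=
  exists (r : R) (u v : 'rV[R]_N),
    [/\ 0 < r, enorm u = 1, enorm v = 1, dotp u v = 0
      & forall x : R, G x = r *: (cos x *: u + sin x *: v)].

(* Main.v *)
(** Let [w t > 0] be defined by [P (w t) = - t] for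
    [P y = 1/2 \sum_(1 <= k <= m) y ^ (2 k^2)].  The curve in [C^m] with
    components [w^(k^2) e^(i k x)], [k = 1, ..., m], is an orbit of a circle of
    isometries, so its speed is constant in [x], equal to [sqrt (w * P' w)], and
    curve shortening flow reduces to the ODE [w' = - 1 / P' w].  The frequencies
    [0, 1, ..., m] being distinct, the curve spans [R^(2m)] affinely.  As
    [t -> 0], [w -> 0] and the component of frequency 1 dominates all others, so
    the rescaled curve tends to the circle of radius [sqrt 2] traversed once. *)
Require Import Defs.
From mathcomp Require Import all_boot all_order all_algebra.
From mathcomp Require Import all_classical all_reals all_analysis.
From mathcomp Require Import ring lra.

Import Order.TTheory GRing.Theory Num.Theory.
Import numFieldNormedType.Exports.

Local Open Scope classical_set_scope.
Local Open Scope ring_scope.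

(** * Calculus and norms of row vectors *)

Lemma derive1_val (R : realType) (V : normedModType R) (f : R -> V) (x : R)
    (df : V) : is_derive x 1 f df -> derive1 f x = df.
Proof. by move=> h; rewrite derive1E derive_val. Qed.

Lemma is_derive_row (R : realType) (N : nat) (f : R -> 'I_N -> R)
    (df : 'I_N -> R) (x : R) :
  (forall i, is_derive x 1 (fun y => f y i) (df i)) ->
  is_derive x 1 (fun y => \row_i f y i) (\row_i df i).
Proof.
move=> h.
have fE j : (fun y => (\row_i f y i) 0 j) = (fun y => f y j).
  by apply/funext => y; rewrite mxE.
have fd : derivable (fun y => \row_i f y i) x 1.
  by apply/derivable_mxP => i j; rewrite ord1 fE; case: (h j).
apply: DeriveDef => //; rewrite derive_mx//; apply/matrixP => i j.
by rewrite !mxE ord1 fE derive_val.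
Qed.

Lemma continuous_row (R : realType) (T : topologicalType) (N : nat)
    (f : T -> 'I_N -> R) (p : T) :
  (forall i, {for p, continuous (f^~ i)}) ->
  {for p, continuous (fun q => \row_i f q i)}.
Proof.
move=> h; apply/cvgrPdist_le => /= e e0; near=> q.
rewrite /Num.Def.normr/= mx_normrE (bigmax_le _ (ltW e0))//= => i _.
rewrite !mxE/=; move: i; near: q; apply: filter_forall => /= i.
by have /cvgrPdist_le := h i.2; exact.
Unshelve. all: by end_near. Qed.

Lemma dotpBr (R : realType) (N : nat) (u v w : 'rV[R]_N) :
  dotp u (v - w) = dotp u v - dotp u w.
Proof.
by rewrite /dotp -sumrB; apply: eq_bigr => i _; rewrite !mxE mulrBr.
Qed.

(** Squaring the right side adds only nonnegative cross terms. The bound reduces convergence of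
    curves to convergence of their components. *)
Lemma enorm_le_sum (R : realType) (N : nat) (u : 'rV[R]_N) :
  enorm u <= \sum_(i < N) `|u 0 i|.
Proof.
have s0 n (F : 'I_n -> R) : 0 <= \sum_(i < n) `|F i| by apply: sumr_ge0.
rewrite /enorm /dotp -[leRHS]ger0_norm// -sqrtr_sqr ler_sqrt ?sqr_ge0//.
elim: N u => [|N IH] u; first by rewrite !big_ord0 expr0n.
rewrite !big_ord_recl.
have := IH (\row_i u 0 (lift ord0 i)).
under eq_bigr do rewrite !mxE.
under [X in _ <= X ^+ 2 -> _]eq_bigr do rewrite !mxE.
have := s0 _ (fun i => u 0 (lift ord0 i)); set S := \sum_(i < N) `|_|.
move=> S0 h; rewrite sqrrD -normrX [in leRHS]ger0_norm ?sqr_ge0// expr2 -addrA.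
by rewrite lerD2l (le_trans h)// lerDr mulrn_wge0// mulr_ge0.
Qed.

(** * Normal vectors of subspaces and independence of harmonics *)

(** A basis of [V] gives a matrix with fewer than [N] rows, so its transpose has a nontrivial left
    kernel. *)
Lemma annihilator_exists (R : realType) (N : nat) (V : {vspace 'rV[R]_N}) :
  (\dim V < N)%N ->
  exists2 l : 'rV[R]_N, l != 0 & forall v, v \in V -> dotp l v = 0.
Proof.
move=> dV; pose A := \matrix_(i < \dim V) tnth (vbasis V) i.
exists (nz_row (kermx A^T)).
  rewrite nz_row_eq0 kermx_eq0 /row_free neq_ltn.
  by rewrite (leq_ltn_trans (rank_leq_col _) dV).
move=> v /coord_vbasis ->.
have : nz_row (kermx A^T) *m A^T = 0 by apply/sub_kermxP; exact: nz_row_sub.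
set l := nz_row _ => lA.
have lb i : dotp l (vbasis V)`_i = 0.
  have [iV|Vi] := ltnP i (\dim V); last first.
    (* Past the end of the basis, [nth] returns the zero vector. *)
    rewrite nth_default ?size_tuple// /dotp big1// => j _.
    by rewrite mxE mulr0.
  have /matrixP/(_ 0 (Ordinal iV)) := lA; rewrite !mxE => e.
  by rewrite -[RHS]e; apply: eq_bigr => j _; rewrite !mxE (tnth_nth 0).
rewrite /dotp.
under eq_bigr => i _ do rewrite summxE mulr_sumr.
rewrite exchange_big big1//= => i _.
under eq_bigr => j _ do rewrite mxE mulrCA.
by rewrite -mulr_sumr -/(dotp l _) lb mulr0.
Qed.

(* [f(. + h) + f(. - h) + 2 f] with [h = pi / (n + 1)] kills the top frequency
   [n + 1] and rescales every smaller one by a nonzero factor. *)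
Lemma trig_free (R : realType) (n : nat) (c : R) (a b : nat -> R) :
  (forall x, c + \sum_(j < n) (a j * cos (j.+1%:R * x) +
                               b j * sin (j.+1%:R * x)) = 0) ->
  forall j, (j < n)%N -> a j = 0 /\ b j = 0.
Proof.
elim: n c a b => // n IH c a b H.
pose h : R := pi / n.+1%:R.
have n0 : n.+1%:R != 0 :> R by rewrite pnatr_eq0.
pose d j : R := 2 * (cos (j.+1%:R * h) + 1).
have dE : n.+1%:R * h = pi by rewrite /h mulrC divfK.
have d0 j : (j < n)%N -> d j != 0.
  (* A zero factor would mean [cos (j.+1 * h) = cos pi], which injectivity of [cos] on [[0, pi]]
     excludes since [j.+1 * h < pi]. *)
  move=> jn; rewrite mulf_neq0// addr_eq0 -cospi; apply/eqP.
  have jh : j.+1%:R * h < pi.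
    by rewrite -dE ltr_pM2r ?ltr_nat// divr_gt0 ?pi_gt0.
  move=> /cos_inj e; move: (jh); rewrite e ?ltxx// in_itv/= ?pi_ge0 ?lexx//.
  by rewrite (ltW jh) mulr_ge0// divr_ge0 ?pi_ge0.
have ab0 j : (j < n)%N -> a j = 0 /\ b j = 0.
  move=> jn.
  (* The constant term picks up [c + c + 2 * c]. *)
  have [||da db] := IH (4 * c) (fun j => d j * a j) (fun j => d j * b j) _ j.
  - move=> x; have := H (x + h); have := H (x - h); have := H x.
    rewrite !big_ord_recr/= !mulrDr !mulrN dE.
    rewrite (cosB _ pi) (cosD _ pi) (sinB _ pi) (sinD _ pi) cospi sinpi.
    have -> : \sum_(j < n) (d j * a j * cos (j.+1%:R * x) +
                            d j * b j * sin (j.+1%:R * x)) =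
      \sum_(j < n) (a j * cos (j.+1%:R * (x + h)) +
                    b j * sin (j.+1%:R * (x + h))) +
      \sum_(j < n) (a j * cos (j.+1%:R * (x - h)) +
                    b j * sin (j.+1%:R * (x - h))) +
      2 * \sum_(j < n) (a j * cos (j.+1%:R * x) + b j * sin (j.+1%:R * x)).
      rewrite mulr_sumr -!big_split/=; apply: eq_bigr => i _.
      by rewrite !mulrDr !mulrN cosB cosD sinB sinD /d; ring.
    set s1 := \sum_(_ < _) _; set s2 := \sum_(_ < _) _.
    set s3 := \sum_(_ < _) _ => h1 h2 h3; lra.
  - by [].
  by split; apply/eqP; [move/eqP: da|move/eqP: db];
    rewrite mulf_eq0 (negbTE (d0 _ jn)).
have H' x : c + (a n * cos (n.+1%:R * x) + b n * sin (n.+1%:R * x)) = 0.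
  rewrite -[RHS](H x) big_ord_recr/= big1 ?add0r// => i _.
  by have [-> ->] := ab0 i (ltn_ord i); rewrite !mul0r addr0.
(* Only the top frequency is left. At phases [0], [pi] and [pi / 2] it gives [c + a n = 0],
   [c - a n = 0] and [c + b n = 0]. *)
have := H' 0; have := H' h; have := H' (h / 2).
rewrite mulrA dE mulr0 cos0 sin0 cospi sinpi cos_pihalf sin_pihalf => h1 h2 h3.
move=> j; rewrite ltnS leq_eqVlt => /predU1P[->|]; last exact: ab0.
by split; lra.
Qed.

(** * Curves with harmonic components and their geometry *)

Lemma sum_pairs (R : realType) (m : nat) (F : nat -> R) :
  \sum_(i < 2 * m) F i = \sum_(j < m) (F j.*2 + F j.*2.+1).
Proof.
rewrite mul2n; elim: m => [|m IH]; first by rewrite !big_ord0.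
by rewrite doubleS !big_ord_recr/= IH addrA.
Qed.

(** Coordinates [2 * j] and [2 * j + 1] span the plane that rotates at frequency [j + 1]. *)
Definition freq (i : nat) : nat := i./2.+1.

Definition phase (R : realType) (i : nat) : R := - ((odd i)%:R * (pi / 2)).

(** Arbitrary amplitudes and phases make this class stable under differentiation in [x], which
    multiplies amplitudes by the frequency and adds [pi / 2] to the phases. *)
Definition harm (R : realType) (N : nat) (a b : nat -> R) (x : R) : 'rV[R]_N :=
  \row_i (a i * cos ((freq i)%:R * x + b i)).

(* Since [cos (x - pi / 2) = sin x], the components are
   [r k * cos (k x), r k * sin (k x)] for [k = 1, 2, ...]. *)
Definition torus_curve (R : realType) (N : nat) (r : nat -> R) :
    R -> 'rV[R]_N :=
  harm R N (fun i => r (freq i)) (phase R).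

Lemma is_derive_harm (R : realType) (N : nat) (a b : nat -> R) (x : R) :
  is_derive x 1 (harm R N a b)
    (harm R N (fun i => a i * (freq i)%:R) (fun i => b i + pi / 2) x).
Proof.
apply: is_derive_row => i; rewrite addrA cosDpihalf.
have lin : is_derive x 1 (fun y => (freq i)%:R * y + b i) ((freq i)%:R : R).
  by apply: trigger_derive; rewrite addr0 /GRing.scale/= mulr1.
have := is_deriveZ (a i) (is_derive1_comp (is_derive_cos _) lin).
rewrite /GRing.scale/= => /trigger_derive; apply.
by rewrite mulrCA mulrC.
Qed.

Lemma derive1n_harm (R : realType) (N : nat) (a b : nat -> R) (n : nat) :
  derive1n n (harm R N a b) =
  harm R N (fun i => a i * (freq i)%:R ^+ n) (fun i => b i + n%:R * (pi / 2)).
Proof.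
elim: n => [|n IH].
  rewrite derive1n0; congr harm; apply/funext => i.
    by rewrite expr0 mulr1.
  by rewrite mul0r addr0.
rewrite derive1nS IH; apply/funext => x.
rewrite (derive1_val _ _ _ _ _ (is_derive_harm _ _ _ _ _)); congr harm.
  by apply/funext => i; rewrite exprSr mulrA.
by apply/funext => i; rewrite -(natr1 n) (mulrDl n%:R) mul1r addrA.
Qed.

Lemma smooth_harm (R : realType) (N : nat) (a b : nat -> R) :
  smooth (harm R N a b).
Proof.
move=> n x; rewrite derive1n_harm.
have h := is_derive_harm R N (fun i => a i * (freq i)%:R ^+ n)
  (fun i => b i + n%:R * (pi / 2)) x.
exact: ex_derive.
Qed.

(** In each coordinate pair the variable [x] disappears through [cos ^ 2 + sin ^ 2 = 1]. *)
Lemma speed_torus_curve (R : realType) (m : nat) (r : nat -> R) (x : R) :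
  speed (torus_curve R (2 * m) r) x =
  Num.sqrt (\sum_(j < m) (r j.+1 * j.+1%:R) ^+ 2).
Proof.
rewrite /speed (derive1_val _ _ _ _ _ (is_derive_harm _ _ _ _ _)).
rewrite /enorm; congr Num.sqrt; rewrite /dotp.
under eq_bigr => i _ do rewrite !mxE.
rewrite (sum_pairs R m (fun i => (r (freq i) * (freq i)%:R *
  cos ((freq i)%:R * x + (phase R i + pi / 2))) *
  (r (freq i) * (freq i)%:R *
   cos ((freq i)%:R * x + (phase R i + pi / 2))))).
apply: eq_bigr => j _.
rewrite /freq /phase /= odd_double uphalf_double doubleK/=.
rewrite mul0r mul1r oppr0 add0r addNr addr0 cosDpihalf.
set k := j.+1%:R; rewrite mulrN mulrNN -!expr2.
rewrite [in LHS]exprMn [X in _ + X]exprMn.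
by rewrite -mulrDr addrC cos2Dsin2 mulr1.
Qed.

(** As the speed is constant, the Laplacian is the second derivative divided by the squared speed;
    two derivatives shift the phase by [pi], whence the sign. *)
Lemma laplacian_torus_curve (R : realType) (m : nat) (r : nat -> R) (x : R) :
  laplacian (torus_curve R (2 * m) r) (torus_curve R (2 * m) r) x =
  \row_i (- ((freq i)%:R ^+ 2 * r (freq i) /
             \sum_(j < m) (r j.+1 * j.+1%:R) ^+ 2) *
          cos ((freq i)%:R * x + phase R i)).
Proof.
rewrite /laplacian.
under [X in derive1 X]eq_fun do rewrite speed_torus_curve.
rewrite speed_torus_curve; set S := \sum_(_ < _) _.
set g := torus_curve _ _ _; have g2 := derive1n_harm R (2 * m)
  (fun i => r (freq i)) (phase R) 2.
have d2 : derivable (derive1 g) x 1 := smooth_harm _ _ _ _ 1%N x.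
rewrite derive1E deriveZ//= -derive1E scalerA -expr2 exprVn.
rewrite sqr_sqrtr; last first.
  by apply: sumr_ge0 => i _; exact: sqr_ge0.
rewrite [derive1 (derive1 g)]g2; apply/rowP => i; rewrite !mxE.
have -> : 2%:R * (pi / 2) = pi :> R by rewrite mulrC divfK// pnatr_eq0.
by rewrite addrA cosDpi; ring.
Qed.

Lemma immersed_torus_curve (R : realType) (m : nat) (r : nat -> R) :
  0 < \sum_(j < m) (r j.+1 * j.+1%:R) ^+ 2 ->
  immersed_closed_curve (torus_curve R (2 * m) r).
Proof.
move=> S0; split; first exact: smooth_harm.
- have cosDn (n : nat) y : cos (y + n%:R * (pi *+ 2)) = cos y :> R.
    elim: n => [|n IH]; first by rewrite mul0r addr0.
    by rewrite -(natr1 n) (mulrDl n%:R) mul1r addrA cosD2pi.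
  move=> x; apply/rowP => i; rewrite !mxE mulrDr addrAC.
  by rewrite [2 * pi]mulr_natl cosDn.
- move=> x; apply/negP => /eqP d0; have := speed_torus_curve R m r x.
  rewrite /speed d0 /enorm /dotp big1 ?sqrtr0 => [e|i _]; last first.
    by rewrite mxE mul0r.
  by move: S0; rewrite -sqrtr_gt0 -e ltxx.
Qed.

(** Pairing the curve with a normal vector [l] of [V] yields a vanishing trigonometric polynomial
    with constant term [- dotp l p]. By [trig_free] its coefficients vanish, and nonzero radii then
    force [l = 0]. *)
Lemma torus_curve_full (R : realType) (m : nat) (r : nat -> R)
    (p : 'rV[R]_(2 * m)) (V : {vspace 'rV[R]_(2 * m)}) :
  (forall k, r k != 0) -> (\dim V < 2 * m)%N ->
  ~ lies_in_affine (torus_curve R (2 * m) r) p V.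
Proof.
move=> r0 /annihilator_exists[l l0 lV] gV.
case/negP: l0; apply/eqP.
(* Extension of [l] by zero to all of [nat], the index type of [sum_pairs] and [trig_free]. *)
pose L i := if insub i is Some j then l 0 j else 0.
have LE (i : 'I_(2 * m)) : L i = l 0 i by rewrite /L valK.
have key j : (j < m)%N -> L j.*2 * r j.+1 = 0 /\ L j.*2.+1 * r j.+1 = 0.
  apply: (trig_free R m (- dotp l p) (fun j => L j.*2 * r j.+1)
            (fun j => L j.*2.+1 * r j.+1)) => x.
  have := lV _ (gV x); rewrite dotpBr addrC => e; rewrite -[RHS]e.
  congr (_ + _).
  rewrite /dotp; under [RHS]eq_bigr => i _ do rewrite -LE mxE.
  rewrite (sum_pairs R m (fun i => L i * (r (freq i) *
    cos ((freq i)%:R * x + phase R i)))).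
  apply: eq_bigr => k _.
  rewrite /freq /phase /= odd_double uphalf_double doubleK/=.
  rewrite mul0r mul1r oppr0 addr0 (cosB _ (pi / 2)) cos_pihalf sin_pihalf.
  by rewrite mulr0 add0r mulr1 !mulrA.
apply/rowP => i; rewrite mxE -LE.
have im : (i./2 < m)%N.
  rewrite -ltn_double -(mul2n m) (leq_ltn_trans _ (ltn_ord i))//.
  by rewrite -[leqRHS]odd_double_half leq_addl.
have [e o] := key _ im; have rn0 := r0 i./2.+1.
rewrite -(odd_double_half i); case: (odd i); rewrite ?add1n ?add0n.
  by apply/eqP; move/eqP: o; rewrite mulf_eq0 (negbTE rn0) orbF.
by apply/eqP; move/eqP: e; rewrite mulf_eq0 (negbTE rn0) orbF.
Qed.

(** * The width function and its differential equation *)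

(* Half the squared radius of [torus_curve] with radii [y ^+ (k ^ 2)]; it
   decreases at unit rate along the flow. *)
Definition half_sqnorm (R : realType) (m : nat) : {poly R} :=
  \sum_(j < m) 2^-1 *: 'X^(2 * j.+1 ^ 2).

(** The function [w] of the overview, meaningful only for [0 < m] and [t < 0]. *)
Definition width (R : realType) (m : nat) (t : R) : R :=
  get [set y | 0 < y /\ (half_sqnorm R m).[y] = - t].

Lemma half_sqnormE (R : realType) (m : nat) (y : R) :
  (half_sqnorm R m).[y] = \sum_(j < m) 2^-1 * y ^+ (2 * j.+1 ^ 2).
Proof.
by rewrite horner_sum; apply: eq_bigr => i _; rewrite hornerZ hornerXn.
Qed.

Lemma half_sqnorm_homo (R : realType) (m : nat) (x y : R) : (0 < m)%N ->
  0 <= x -> x < y -> (half_sqnorm R m).[x] < (half_sqnorm R m).[y].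
Proof.
case: m => // m _ x0 xy; have y0 : 0 <= y by rewrite (le_trans x0)// ltW.
rewrite !half_sqnormE !big_ord_recl ltr_leD//.
  by rewrite ltr_pM2l ?invr_gt0// ltr_pXn2r.
by apply: ler_sum => i _; rewrite ler_pM2l ?invr_gt0// lerXn2r// ltW.
Qed.

Lemma half_sqnorm_inj (R : realType) (m : nat) (x y : R) : (0 < m)%N ->
  0 < x -> 0 < y -> (half_sqnorm R m).[x] = (half_sqnorm R m).[y] -> x = y.
Proof.
move=> m0 x0 y0 e; have [xy|yx|//] := ltgtP x y.
  by have := half_sqnorm_homo R m _ _ m0 (ltW x0) xy; rewrite e ltxx.
by have := half_sqnorm_homo R m _ _ m0 (ltW y0) yx; rewrite e ltxx.
Qed.

(** The term of frequency 1 alone. It bounds [P] from below for the intermediate value theorem, and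
    later forces [w] to tend to [0]. *)
Lemma half_sqnorm_ge (R : realType) (m : nat) (y : R) : (0 < m)%N ->
  0 <= y -> 2^-1 * y ^+ 2 <= (half_sqnorm R m).[y].
Proof.
case: m => // m _ y0; rewrite half_sqnormE big_ord_recl lerDl.
by apply: sumr_ge0 => i _; rewrite mulr_ge0// exprn_ge0.
Qed.

Lemma widthP (R : realType) (m : nat) (t : R) : (0 < m)%N -> t < 0 ->
  0 < width R m t /\ (half_sqnorm R m).[width R m t] = - t.
Proof.
(* The bound [b] solves [b ^ 2 / 2 = - t], so [P b >= - t]. *)
move=> m0 t0; pose b : R := Num.sqrt (2 * - t).
suff [y yP] : exists y, 0 < y /\ (half_sqnorm R m).[y] = - t.
  exact: (@getI _ [set y | 0 < y /\ (half_sqnorm R m).[y] = - t] y yP).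
have P0 : (half_sqnorm R m).[0] = 0.
  by rewrite half_sqnormE big1// => i _; rewrite expr0n/= mulr0.
have Pb : - t <= (half_sqnorm R m).[b].
  apply: le_trans (half_sqnorm_ge R m b m0 (sqrtr_ge0 _)).
  by rewrite sqr_sqrtr ?mulKf// mulr_ge0// oppr_ge0 ltW.
have [||y] := @IVT _ (horner (half_sqnorm R m)) 0 b (- t) (sqrtr_ge0 _).
- exact/continuous_subspaceT/continuous_horner.
- rewrite P0 ge_min le_max Pb orbT andbT oppr_ge0 (ltW t0)//.
rewrite in_itv/= => /andP[y0 _] yt; exists y; split=> //.
rewrite lt_neqAle y0 andbT; apply/eqP => e0.
by move: t0; rewrite -oppr_gt0 -yt -e0 P0 ltxx.
Qed.

Lemma width_gt0 (R : realType) (m : nat) (t : R) : (0 < m)%N -> t < 0 ->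
  0 < width R m t.
Proof. by move=> m0 t0; have [] := widthP R m t m0 t0. Qed.

Lemma widthK (R : realType) (m : nat) (t : R) : (0 < m)%N -> t < 0 ->
  (half_sqnorm R m).[width R m t] = - t.
Proof. by move=> m0 t0; have [] := widthP R m t m0 t0. Qed.

(** Identifies [y * P' y] with the squared speed of the torus curve of radii [y ^+ (k ^ 2)]; each
    coefficient [2 * k ^ 2 / 2] of the left side is the squared frequency. *)
Lemma horner_deriv_half_sqnorm (R : realType) (m : nat) (y : R) :
  y * (half_sqnorm R m)^`().[y] =
  \sum_(j < m) (y ^+ (j.+1 ^ 2) * j.+1%:R) ^+ 2.
Proof.
rewrite /half_sqnorm (raddf_sum (@deriv R)) horner_sum mulr_sumr.
apply: eq_bigr => j _; rewrite /= derivZ derivXn hornerZ hornerMn hornerXn exprMn.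
rewrite -exprM mulnC.
have e0 : (0 < j.+1 ^ 2 * 2)%N by rewrite muln_gt0 expn_gt0.
rewrite -[in RHS](prednK e0) exprS -[_ *+ (j.+1 ^ 2 * 2)]mulr_natr natrM natrX.
by set z := y ^+ _; field.
Qed.

Lemma deriv_half_sqnorm_gt0 (R : realType) (m : nat) (y : R) : (0 < m)%N ->
  0 < y -> 0 < (half_sqnorm R m)^`().[y].
Proof.
case: m => // m _ y0; rewrite -(pmulr_rgt0 _ y0) horner_deriv_half_sqnorm.
rewrite big_ord_recl ltr_wpDr//.
  by apply: sumr_ge0 => i _; exact: sqr_ge0.
by rewrite exprn_gt0// mulr_gt0// exprn_gt0.
Qed.

(** Derivative of an inverse function: [w] inverts [- P] on the positive axis, where [P' > 0]. *)
Lemma is_derive_width (R : realType) (m : nat) (t : R) : (0 < m)%N -> t < 0 ->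
  is_derive t 1 (width R m) (- ((half_sqnorm R m)^`().[width R m t])^-1).
Proof.
move=> m0 t0; have w0 := width_gt0 R m t m0 t0.
have D0 := deriv_half_sqnorm_gt0 R m _ m0 w0.
have wt : (- half_sqnorm R m).[width R m t] = t.
  by rewrite hornerN widthK// opprK.
(* The base point [t] is written as the value of [- P] at [w t], the form needed by
   [is_derive_inverse]. *)
rewrite -[in X in is_derive X]wt -invrN -hornerN -derivN.
apply: is_derive_inverse; last by rewrite derivN hornerN oppr_eq0 gt_eqF.
  near=> y; have y0 : 0 < y by near: y; exact: lt_nbhsr.
  have Py0 : 0 < (half_sqnorm R m).[y].
    rewrite (lt_le_trans _ (half_sqnorm_ge R m y m0 (ltW y0)))//.
    by rewrite mulr_gt0// exprn_gt0.
  have ht : - (half_sqnorm R m).[y] < 0 by rewrite oppr_lt0.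
  rewrite hornerN; apply: (half_sqnorm_inj R m) => //; first exact: width_gt0.
  by rewrite widthK// opprK.
by near=> y; exact: continuous_horner.
Unshelve. all: by end_near. Qed.

(** Squeezed by [w ^ 2 / 2 <= P w = - t]. *)
Lemma cvg_width0 (R : realType) (m : nat) : (0 < m)%N ->
  width R m t @[t --> 0^'-] --> (0 : R).
Proof.
move=> m0; apply/cvgrPdist_lt => /= e e0.
have e2 : 0 < 2^-1 * e ^+ 2 by rewrite mulr_gt0// exprn_gt0.
near=> t; have t0 : t < 0 by near: t; exact: nbhs_left_lt.
have w0 := width_gt0 R m t m0 t0.
rewrite sub0r normrN gtr0_norm// -(ltr_pXn2r (ltn0Sn 1)) ?nnegrE ?ltW//.
rewrite -(ltr_pM2l (x := 2^-1))//.
rewrite (le_lt_trans (half_sqnorm_ge R m _ m0 (ltW w0)))// widthK// ltrNl.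
by near: t; apply: nbhs_left_gt; rewrite oppr_lt0.
Unshelve. all: by end_near. Qed.

(** * Joint smoothness in time and space *)

Lemma is_derive_frac (R : realType) (p q : {poly R}) (n : nat) (y : R) :
  q.[y] != 0 ->
  is_derive y 1 (fun z => p.[z] / q.[z] ^+ n)
    ((p^`() * q - p * q^`() *+ n).[y] / q.[y] ^+ n.+1).
Proof.
move=> q0.
have dV := is_deriveV q0 (is_derive_poly q y).
have -> : (fun z => p.[z] / q.[z] ^+ n) =
    horner p * (fun z => q.[z]^-1) ^+ n.
  by apply/funext => z; rewrite mulrfctE exprfctE exprVn.
apply: trigger_derive.
change (p.[y] * (n%:R * q.[y]^-1 ^+ n.-1 * (- q.[y] ^- 2 * q^`().[y])) +
  ((fun z => q.[z]^-1) ^+ n) y * p^`().[y] =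
  (p^`() * q - p * q^`() *+ n).[y] / q.[y] ^+ n.+1).
rewrite exprfctE hornerD hornerN hornerMn !hornerM -mulr_natr.
(* The power rule produces [n.-1], so [n = 0] is treated apart. *)
case: n => [|n] /=; first by rewrite !expr0 expr1; field.
rewrite !exprVn !exprS.
by set N := n.+1%:R; set z := q.[y] ^+ n; field; rewrite /z expf_neq0.
Qed.

(** In the chain rule the factor [w' = - 1 / q w] changes the sign and adds one more power of [q] to
    the denominator. *)
Lemma is_derive_frac_width (R : realType) (m : nat) (p : {poly R}) (n : nat)
    (t : R) (q := (half_sqnorm R m)^`()) : (0 < m)%N -> t < 0 ->
  is_derive t 1 (fun s => p.[width R m s] / q.[width R m s] ^+ n)
    ((- (p^`() * q - p * q^`() *+ n)).[width R m t] /
     q.[width R m t] ^+ n.+2).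
Proof.
move=> m0 t0; have w0 := width_gt0 R m t m0 t0.
have q0 : q.[width R m t] != 0 by rewrite gt_eqF ?deriv_half_sqnorm_gt0.
have := is_derive1_comp (is_derive_frac R p q n _ q0)
  (is_derive_width R m t m0 t0).
move/trigger_derive; apply.
by rewrite -/q [in RHS]hornerN [in RHS]exprSr invfM; ring.
Qed.

Lemma is_derive_harm_coef (R : realType) (N : nat) (c : R -> nat -> R)
    (dc b : nat -> R) (t x : R) :
  (forall i, is_derive t 1 (c^~ i) (dc i)) ->
  is_derive t 1 (fun s => harm R N (c s) b x) (harm R N dc b x).
Proof.
move=> h; apply: is_derive_row => i; set C := cos _.
have := is_deriveZ C (h i) => /trigger_derive.
rewrite (_ : C \*: c^~ i = (fun s => c s i * C)); last first.
  by apply/funext => s; rewrite mulrC.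
by apply; rewrite mulrC.
Qed.

(** Each component is a function of time times a function of [x], so separate continuity
    suffices. *)
Lemma continuous_harm_frac (R : realType) (N m n : nat) (p : nat -> {poly R})
    (b : nat -> R) (t x : R) (q := (half_sqnorm R m)^`()) :
  (0 < m)%N -> t < 0 ->
  {for (t, x), continuous (fun z : R * R => harm R N
    (fun i => (p i).[width R m z.1] / q.[width R m z.1] ^+ n) b z.2)}.
Proof.
move=> m0 t0; apply: continuous_row => i.
have h := is_derive_frac_width R m (p i) n t m0 t0.
have cd : {for t, continuous
    (fun s => (p i).[width R m s] / q.[width R m s] ^+ n)}.
  apply/differentiable_continuous/derivable1_diffP; exact: ex_derive.
apply: (@cvgM _ _ _ _ (fun z : R * R =>
  (p i).[width R m z.1] / q.[width R m z.1] ^+ n)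
  (fun z : R * R => cos ((freq i)%:R * z.2 + b i))).
  apply: (cvg_comp fst
    (fun s => (p i).[width R m s] / q.[width R m s] ^+ n) _ cd).
  exact: cvg_fst.
apply: (continuous_comp (f := fun z : R * R => (freq i)%:R * z.2 + b i)
  (g := cos)); last exact: continuous_cos.
by apply: cvgD; [apply: cvgM; [exact: cvg_cst|exact: cvg_snd]|exact: cvg_cst].
Qed.

(* With [w' = - 1 / q w] for [q = P'], the functions [p w / q w ^ n] ([p] a
   polynomial) are stable under differentiation in time. *)
Lemma Ck_family_harm (R : realType) (N m : nat) (k n : nat)
    (p : nat -> {poly R}) (b : nat -> R) (f : R -> R -> 'rV[R]_N)
    (q := (half_sqnorm R m)^`()) : (0 < m)%N ->
  (forall t x : R, t < 0 ->
    f t x = harm R N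
      (fun i => (p i).[width R m t] / q.[width R m t] ^+ n) b x) ->
  Ck_family k f.
Proof.
move=> m0; elim: k n p b f => [|k IH] n p b f fE;
  have fc (t x : R) : t < 0 -> {for (t, x), continuous (fun z => f z.1 z.2)}.
(* The formula for [f] holds only at negative times, but these form a neighbourhood of [(t, x)], so
   the limit transfers. *)
1, 3: move=> t0; have lim := continuous_harm_frac R N m n p b t x m0 t0;
  change (f z.1 z.2 @[z --> (t, x)] --> f t x); rewrite fE//;
  apply: cvg_trans lim; apply: near_eq_cvg;
  have near_t : \forall z \near (t, x), z.1 < 0
    by exact: (@cvg_fst _ _ (nbhs t) (nbhs x) _ _ (lt_nbhsl t0)).
1, 2: by apply: filterS near_t => z z0; rewrite fE.
  by [].
have tE (t x : R) : t < 0 -> is_derive t 1 (f^~ x)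
    (harm R N (fun i => (- ((p i)^`() * q - p i * q^`() *+ n)).[width R m t] /
                        q.[width R m t] ^+ n.+2) b x).
  move=> t0.
  have h := is_derive_harm_coef R N
    (fun s i => (p i).[width R m s] / q.[width R m s] ^+ n) _ b t x
    (fun i => is_derive_frac_width R m (p i) n t m0 t0).
  apply: near_eq_is_derive h.
  by near=> s; rewrite fE//; near: s; exact: lt_nbhsl.
have xE (t : R) : t < 0 -> f t = harm R N
    (fun i => (p i).[width R m t] / q.[width R m t] ^+ n) b.
  by move=> t0; apply/funext => x; exact: fE.
split=> //; split.
- move=> t x t0; split; first by have h := tE t x t0; exact: ex_derive.
  by rewrite xE//; exact: (smooth_harm R N _ _ 0%N).
(* A time derivative raises the denominator exponent by two; the space derivative below keeps it and
   changes only amplitudes and phases. *)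
- apply: (IH n.+2 (fun i => - ((p i)^`() * q - p i * q^`() *+ n)) b).
  by move=> t x t0; rewrite (derive1_val _ _ _ _ _ (tE t x t0)).
- apply: (IH n (fun i => p i * (freq i)%:R) (fun i => b i + pi / 2)).
  move=> t x t0; rewrite xE//.
  rewrite (derive1_val _ _ _ _ _ (is_derive_harm _ _ _ _ _)).
  congr harm; apply/funext => i.
  by rewrite hornerM -mulrA mulrAC mulrA -polyC_natr hornerC mulrAC.
Unshelve. all: by end_near. Qed.

(** * The flow equation *)

Definition flow (R : realType) (m : nat) (t : R) : R -> 'rV[R]_(2 * m) :=
  torus_curve R (2 * m) (fun k => width R m t ^+ (k ^ 2)).

(** The exponent [k ^ 2] matches the eigenvalue of frequency [k]: the radius [w ^ (k ^ 2)] has time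
    derivative [- k ^ 2 * w ^ (k ^ 2 - 1) / P' w], and the Laplacian gives
    [- k ^ 2 * w ^ (k ^ 2) / (w * P' w)]. *)
Lemma ancient_csf_flow (R : realType) (m : nat) : (0 < m)%N ->
  ancient_csf (flow R m).
Proof.
move=> m0; have S0 t : t < 0 ->
    0 < \sum_(j < m) (width R m t ^+ (j.+1 ^ 2) * j.+1%:R) ^+ 2.
  move=> t0; rewrite -horner_deriv_half_sqnorm.
  by rewrite mulr_gt0 ?deriv_half_sqnorm_gt0 ?width_gt0.
have wE t k : width R m t ^+ (k ^ 2) = ('X^(k ^ 2)).[width R m t] /
    (half_sqnorm R m)^`().[width R m t] ^+ 0.
  by rewrite hornerXn expr0 divr1.
split.
- move=> k; apply: (Ck_family_harm R (2 * m) m k 0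
    (fun i => 'X^(freq i ^ 2)) (phase R)) => // t x t0.
  by rewrite /flow /torus_curve; congr harm; apply/funext => i.
- by move=> t t0; apply: immersed_torus_curve; exact: S0.
- move=> t x t0; rewrite laplacian_torus_curve.
  rewrite -horner_deriv_half_sqnorm.
  have h := is_derive_harm_coef R (2 * m) _ _ (phase R) t x
    (fun i => is_derive_frac_width R m 'X^(freq i ^ 2) 0 t m0 t0).
  have -> : flow R m ^~ x = (fun s => harm R (2 * m) (fun i =>
      ('X^(freq i ^ 2)).[width R m s] /
      (half_sqnorm R m)^`().[width R m s] ^+ 0) (phase R) x).
    by apply/funext => s; congr harm; apply/funext => i; rewrite wE.
  rewrite (derive1_val _ _ _ _ _ h); apply/rowP => i; rewrite !mxE.
  congr (_ * _); rewrite mulr0n subr0 hornerN hornerM derivXn hornerMn hornerXn.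
  have w0 := width_gt0 R m t m0 t0.
  have D0 := deriv_half_sqnorm_gt0 R m _ m0 w0.
  have k0 : (0 < freq i ^ 2)%N by rewrite expn_gt0.
  rewrite -[in RHS](prednK k0) (exprS _ (_.-1)) -mulr_natr natrX expr2.
  set K := (freq i)%:R; set W := width R m t ^+ _; set D := _.[_].
  by field; rewrite !gt_eqF.
Qed.

(** * Rescaling and the tangent flow *)

(** The polynomial [P y / y ^ 2]. For [0 < m] it does not vanish at [0], so the rescaled radii
    extend continuously to width [0]. *)
Definition reduced_half_sqnorm (R : realType) (m : nat) : {poly R} :=
  \sum_(j < m) 2^-1 *: 'X^(2 * (j.+1 ^ 2).-1).

Definition rescaled_radius (R : realType) (m : nat) (y : R) (k : nat) : R :=
  y ^+ (k ^ 2).-1 / Num.sqrt (reduced_half_sqnorm R m).[y].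

Lemma half_sqnorm_factor (R : realType) (m : nat) (y : R) :
  (half_sqnorm R m).[y] = y ^+ 2 * (reduced_half_sqnorm R m).[y].
Proof.
rewrite half_sqnormE horner_sum mulr_sumr; apply: eq_bigr => j _.
by rewrite hornerZ hornerXn mulrCA -exprD -mulnS prednK// expn_gt0.
Qed.

(** One factor [w] cancels, because [- t = P w] makes [sqrt (- t)] equal to [w] times the square
    root of the reduced polynomial. *)
Lemma rescaled_radiusE (R : realType) (m : nat) (t : R) (k : nat) :
  (0 < m)%N -> t < 0 -> (0 < k)%N ->
  (Num.sqrt (- t))^-1 * width R m t ^+ (k ^ 2) =
  rescaled_radius R m (width R m t) k.
Proof.
move=> m0 t0 k0; have w0 := width_gt0 R m t m0 t0.
have k2 : (0 < k ^ 2)%N by rewrite expn_gt0 k0.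
rewrite -(widthK R m t m0 t0) half_sqnorm_factor sqrtrM ?sqr_ge0//.
rewrite sqrtr_sqr gtr0_norm// -[in LHS](prednK k2) exprS invfM /rescaled_radius.
by rewrite mulrCA mulrA mulrCA mulKf ?gt_eqF// mulrC.
Qed.

Lemma reduced_half_sqnorm0 (R : realType) (m : nat) : (0 < m)%N ->
  (reduced_half_sqnorm R m).[0] = 2^-1.
Proof.
case: m => // m _; rewrite horner_sum big_ord_recl big1 => [|i _].
  by rewrite hornerZ hornerXn expr0 mulr1 addr0.
have k2 : (1 ^ 2 < (lift ord0 i).+1 ^ 2)%N by rewrite ltn_exp2r.
have e0 : (0 < 2 * ((lift ord0 i).+1 ^ 2).-1)%N.
  by rewrite muln_gt0 ltn_predRL.
by rewrite hornerZ hornerXn expr0n gtn_eqF// mulr0.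
Qed.

(** The power [0 ^ (k ^ 2 - 1)] is [1] for [k = 1] and [0] for larger [k]. The surviving radius is
    [sqrt 2]. *)
Lemma rescaled_radius0 (R : realType) (m k : nat) : (0 < m)%N -> (0 < k)%N ->
  rescaled_radius R m 0 k = (k == 1)%:R * (Num.sqrt 2^-1)^-1.
Proof.
move=> m0; rewrite /rescaled_radius reduced_half_sqnorm0//.
case: k => [//|[|k]] _; first by rewrite expr0.
have k2 : (1 ^ 2 < k.+2 ^ 2)%N by rewrite ltn_exp2r.
have e0 : (0 < (k.+2 ^ 2).-1)%N by rewrite ltn_predRL.
by rewrite expr0n gtn_eqF.
Qed.

Lemma rescaled_radius_cvg (R : realType) (m k : nat) : (0 < m)%N ->
  rescaled_radius R m (width R m t) k @[t --> 0^'-] -->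
  rescaled_radius R m 0 k.
Proof.
move=> m0; apply: (cvg_comp (width R m) (fun y => rescaled_radius R m y k)).
  exact: cvg_width0.
apply: cvgM; first exact: exprn_continuous.
apply: cvgV.
  by rewrite reduced_half_sqnorm0// gt_eqF// sqrtr_gt0.
apply: (cvg_comp (horner (reduced_half_sqnorm R m))).
  exact: continuous_horner.
exact: sqrt_continuous.
Qed.

Lemma circle_diffeo_id (R : realType) : circle_diffeo (@id R).
Proof.
have D1 : derive1 (@id R) = cst 1.
  by apply/funext => x; rewrite derive1_id.
split; last by left.
- have Dn n : derive1n n.+2 (@id R) = cst 0.
    elim: n => [|n IH].
      rewrite derive1nS derive1n1 D1; apply/funext => x.
      by rewrite derive1_cst.
    by rewrite derive1nS IH; apply/funext => x; rewrite derive1_cst.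
  case=> [|[|n]] x; first exact: derivable_id.
    by rewrite derive1n1 D1; exact: derivable_cst.
  by rewrite Dn; exact: derivable_cst.
- by move=> x; rewrite D1 oner_neq0.
Qed.

(** The identity serves as reparametrization. Phases do not depend on time, so convergence of the
    finitely many radii gives uniform convergence of every derivative. *)
Lemma tangent_flow_flow (R : realType) (m : nat) : (0 < m)%N ->
  tangent_flow_at0 (flow R m) (torus_curve R (2 * m) (rescaled_radius R m 0)).
Proof.
move=> m0; exists (fun _ => id); first by near=> t; exact: circle_diffeo_id.
move=> j e e0.
(* Dividing by [2 * m + 1] keeps the sum of [2 * m] errors strictly below [e]; the division by
   [freq i ^ j] below offsets the factor produced by [j] derivatives. *)
have e1 : 0 < e / (2 * m).+1%:R by rewrite divr_gt0.
have hi : \forall t \near 0^'-, forall i : 'I_(2 * m),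
    `|rescaled_radius R m 0 (freq i) -
      rescaled_radius R m (width R m t) (freq i)| <=
    e / (2 * m).+1%:R / (freq i)%:R ^+ j.
  apply: filter_forall => i.
  have /cvgrPdist_le := rescaled_radius_cvg R m (freq i) m0; apply.
  by rewrite divr_gt0// exprn_gt0// ltr0n.
near=> t; have t0 : t < 0 by near: t; exact: nbhs_left_lt.
have -> : (fun y => (Num.sqrt (- t))^-1 *: flow R m t (id y)) =
    torus_curve R (2 * m) (rescaled_radius R m (width R m t)).
  apply/funext => y; apply/rowP => i; rewrite !mxE mulrA.
  by rewrite rescaled_radiusE.
move=> x; rewrite !derive1n_harm.
apply: le_lt_trans (enorm_le_sum _ _ _) _.
apply: (@le_lt_trans _ _ (\sum_(i < 2 * m) e / (2 * m).+1%:R)).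
  apply: ler_sum => i _; rewrite !mxE -mulrBl -mulrBl !normrM.
  rewrite -[leRHS]mulr1 ler_pM ?mulr_ge0//; last first.
    by rewrite ler_norml cos_geN1 cos_le1.
  rewrite normrX [`|_%:R|]ger0_norm// -ler_pdivlMr ?exprn_gt0// distrC.
  by move: i; near: t.
rewrite sumr_const card_ord -[_ *+ (2 * m)]mulr_natr mulrAC ltr_pdivrMr//.
by rewrite ltr_pM2l// ltr_nat.
Unshelve. all: by end_near. Qed.

Lemma mult1_circle_limit (R : realType) (m : nat) : (0 < m)%N ->
  mult1_circle (torus_curve R (2 * m) (rescaled_radius R m 0)).
Proof.
move=> m0; have m1 : (1 < 2 * m)%N by rewrite mul2n -addnn -addn1 leq_add.
have m2 : (0 < 2 * m)%N by rewrite ltnW.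
have dot_delta a b (am : (a < 2 * m)%N) :
    dotp (\row_(i < 2 * m) (i == a :> nat)%:R)
         (\row_(i < 2 * m) (i == b :> nat)%:R) = (a == b)%:R :> R.
  rewrite /dotp (bigD1 (Ordinal am))//= !mxE eqxx mul1r big1 ?addr0// => i.
  by rewrite !mxE -val_eqE /= => /negbTE ->; rewrite mul0r.
exists (Num.sqrt 2^-1)^-1, (\row_i (i == 0 :> nat)%:R),
  (\row_i (i == 1 :> nat)%:R).
split; rewrite /enorm ?dot_delta ?eqxx ?sqrtr1//.
(* Coordinates [0] and [1] have frequency 1 and carry [cos x] and [sin x]; all others have frequency
   at least 2, hence limit radius zero. *)
move=> x; apply/rowP => -[i im]; rewrite !mxE rescaled_radius0// /freq /phase.
case: i im => [|[|i]] im /=.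
- by rewrite mul0r oppr0 !mul1r !addr0 mulr1 mulr0 addr0.
- rewrite !mul1r (cosB _ (pi / 2)) cos_pihalf sin_pihalf.
  by rewrite !mulr0 mulr1 !add0r.
- by rewrite !mul0r !mulr0 addr0 mulr0.
Qed.

Theorem corollary2p5 (R : realType) (m : nat) (hm : (0 < m)%N) :
  exists (N : nat) (gam : R -> R -> 'rV[R]_N),
    [/\ ancient_csf gam,
        forall t : R, t < 0 ->
          forall (p : 'rV[R]_N) (V : {vspace 'rV[R]_N}),
            (\dim V <= 2 * m - 1)%N -> ~ lies_in_affine (gam t) p V
      & exists2 G : R -> 'rV[R]_N, mult1_circle G & tangent_flow_at0 gam G].
Proof.
exists (2 * m)%N, (flow R m); split; first exact: ancient_csf_flow.
- move=> t t0 p V dV; apply: torus_curve_full => [k|].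
    by rewrite expf_neq0// gt_eqF// width_gt0.
  (* The truncated [2 * m - 1] is a true predecessor because [m] is positive. *)
  by rewrite (leq_ltn_trans dV)// subn1 prednK ?muln_gt0.
- exists (torus_curve R (2 * m) (rescaled_radius R m 0)).
    exact: mult1_circle_limit.
  exact: tangent_flow_flow.
Qed.
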